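(* Let $k$ be a field of characteristic zero. Every $2$-step nilpotent Lie algebra $\mathfrak{g}$ over $k$ admits a complete LR-structure.
   Context: An LR-structure on a Lie algebra $\mathfrak{g}$ over $k$ is a bilinear product $\mathfrak{g}\times\mathfrak{g}\to\mathfrak{g}$, $(x,y)\mapsto x\cdot y$, satisfying for all $x,y,z\in\mathfrak{g}$: $x\cdot(y\cdot z)=y\cdot(x\cdot z)$, $(x\cdot y)\cdot z=(x\cdot z)\cdot y$, and $[x,y]=x\cdot y-y\cdot x$. It is complete if all left multiplications $L(x)\colon y\mapsto x\cdot y$ are nilpotent. *)

(* Defs.v *)
From mathcomp Require Import all_boot all_order all_algebra.

Set Implicit Arguments.
Unset Strict Implicit.
Unset Printing Implicit Defensive.

Import GRing.Theory.
Local Open Scope ring_scope.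

(* A Lie algebra over k is a k-vector space g, of arbitrary dimension, with a
   bilinear bracket br satisfying [lie_bracket br]. *)
Definition lie_bracket (k : fieldType) (g : lmodType k)
    (br : {bilinear g -> g -> g}) : Prop :=
  (forall x, br x x = 0) /\
  (forall x y z, br x (br y z) + br y (br z x) + br z (br x y) = 0).

(* The linear span of a set of vectors; no finite-dimensionality is assumed,
   so {vspace g} is not available. *)
Inductive lin_span (k : fieldType) (g : lmodType k) (S : g -> Prop)
    : g -> Prop :=
| lin_span_gen x : S x -> lin_span S x
| lin_span_zero : lin_span S 0
| lin_span_add x y : lin_span S x -> lin_span S y -> lin_span S (x + y)
| lin_span_scale a x : lin_span S x -> lin_span S (a *: x).

(* Indexed so that the 0th term is g, the 1st is [g, g], the 2nd [g, [g, g]]. *)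
Fixpoint lower_central (k : fieldType) (g : lmodType k)
    (br : {bilinear g -> g -> g}) (n : nat) : g -> Prop :=
  if n is m.+1 then
    lin_span (fun z => exists x y, lower_central br m y /\ z = br x y)
  else fun _ => True.

(* Nilpotency class at most c: minimality of c is not required, so abelian Lie
   algebras are 2-step nilpotent. *)
Definition step_nilpotent (k : fieldType) (g : lmodType k) (c : nat)
    (br : {bilinear g -> g -> g}) : Prop :=
  forall x, lower_central br c x -> x = 0.

Definition LR_structure (k : fieldType) (g : lmodType k)
    (br mul : {bilinear g -> g -> g}) : Prop :=
  [/\ forall x y z, mul x (mul y z) = mul y (mul x z),
      forall x y z, mul (mul x y) z = mul (mul x z) y
    & forall x y, br x y = mul x y - mul y x].

Definition nilpotent_map (k : fieldType) (g : lmodType k) (f : g -> g) : Prop :=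
  exists n : nat, forall y, iter n f y = 0.

Definition complete_LR_structure (k : fieldType) (g : lmodType k)
    (br mul : {bilinear g -> g -> g}) : Prop :=
  LR_structure br mul /\ forall x, nilpotent_map (mul x).

(* Main.v *)
Require Import Defs.
From mathcomp Require Import all_boot all_order all_algebra.
From HB Require Import structures.

(** Halve the bracket: put x.y = 1/2 [x, y], which is where 2 must be
    invertible.  By skew-symmetry x.y - y.x = [x, y].  In a 2-step nilpotent
    Lie algebra all brackets are central, so every product of three elements
    vanishes, on whichever side it is bracketed ([two_step_brr] and
    [two_step_brl]); the two LR identities then read 0 = 0, and left
    multiplications square to zero. *)

Import GRing.Theory.
Local Open Scope ring_scope.

Section ScaledBilinear.

Context {R : comNzRingType} {U V W : lmodType R}.

Definition scale_bilinear (a : R) (f : {bilinear U -> V -> W}) (u : U) (v : V) :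
  W := a *: f u v.

Variables (a : R) (f : {bilinear U -> V -> W}).

Fact scale_bilinear_is_bilinear :
  bilinear_for *:%R *:%R (scale_bilinear a f).
Proof.
split=> [v b u1 u2 | u b v1 v2]; rewrite /scale_bilinear.
  by rewrite linearPl /= scalerDr !scalerA mulrC.
by rewrite linearPr /= scalerDr !scalerA mulrC.
Qed.

HB.instance Definition _ := bilinear_isBilinear.Build R U V W *:%R *:%R
  (scale_bilinear a f) scale_bilinear_is_bilinear.

End ScaledBilinear.

Lemma lie_bracketC {k : fieldType} {g : lmodType k} {br : {bilinear g -> g -> g}} :
  lie_bracket br -> forall x y, br x y = - br y x.
Proof.
move=> [br_alt _] x y; apply/eqP; rewrite -addr_eq0; apply/eqP.
have := br_alt (x + y).
by rewrite linearDl !linearDr !br_alt add0r addr0.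
Qed.

Lemma two_step_brr {k : fieldType} {g : lmodType k} {br : {bilinear g -> g -> g}} :
  step_nilpotent 2 br -> forall x y z, br x (br y z) = 0.
Proof.
move=> br_nil x y z; apply: br_nil; apply: lin_span_gen.
exists x, (br y z); split=> //; apply: lin_span_gen.
by exists y, z.
Qed.

(** The series is built by bracketing on the left only, so this side needs
    skew-symmetry. *)
Lemma two_step_brl {k : fieldType} {g : lmodType k} {br : {bilinear g -> g -> g}} :
  lie_bracket br -> step_nilpotent 2 br -> forall x y z, br (br x y) z = 0.
Proof.
by move=> br_lie br_nil x y z; rewrite (lie_bracketC br_lie) two_step_brr ?oppr0.
Qed.

Theorem proposition4p3 (k : fieldType) (k_char0 : [pchar k] =i pred0)
    (g : lmodType k) (br : {bilinear g -> g -> g})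
    (br_lie : lie_bracket br) (br_nil : step_nilpotent 2 br) :
  exists mul : {bilinear g -> g -> g}, complete_LR_structure br mul.
Proof.
have two_neq0 : 2%:R != 0 :> k by rewrite ((pcharf0P k).1 k_char0).
pose half : k := 2%:R^-1.
have brr := two_step_brr br_nil; have brl := two_step_brl br_lie br_nil.
have mulr x y z : half *: br x (half *: br y z) = 0.
  by rewrite linearZr_LR /= brr !scaler0.
have mull x y z : half *: br (half *: br x y) z = 0.
  by rewrite linearZl_LR /= brl !scaler0.
exists (scale_bilinear half br : {bilinear g -> g -> g}).
split; last by move=> x; exists 2%N => y; apply: mulr.
split=> [x y z | x y z | x y]; rewrite /= /scale_bilinear.
- by rewrite !mulr.
- by rewrite !mull.
- by rewrite (lie_bracketC br_lie y x) scalerN opprK -mulr2n -scaler_nat scalerA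
     mulfV // scale1r.
Qed.
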